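(* Fix a function $f\colon[0,1]\to\mathbb{R}$. Let $D\subset[0,1]$ be a Cantor set with $\{0,1\}\subset D$, and let $(W_n)_{n\in\mathbb{N}}$ be a one-to-one sequence of all connected components of $[0,1]\setminus D$. Then $f\in C[0,1]$ and $D\subset E(f)$ if and only if the following two conditions hold simultaneously: (i) $f|_D=0$, the functions $f|_{\operatorname{cl}(W_n)}$, $n\in\mathbb{N}$, are continuous, and the series $\sum_n \chi_{\operatorname{cl}(W_n)}f$ is uniformly convergent on $[0,1]$; (ii) $D\subset\operatorname{cl}\left(\bigcup_{n\in M^-}W_n\right)\cap\operatorname{cl}\left(\bigcup_{n\in M^+}W_n\right)$, where $M^-:=\{n\colon W_n\cap f^{-1}[(-\infty,0)]\neq\emptyset\}$ and $M^+:=\{n\colon W_n\cap f^{-1}[(0,\infty)]\neq\emptyset\}$.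
   Context: A Cantor set in $\mathbb{R}$ is a nonempty, perfect, compact, nowhere dense subset of $\mathbb{R}$. A function $f\colon[0,1]\to\mathbb{R}$ cuts the real axis at a point $x\in[0,1]$ if $f(x)=0$ and in every neighbourhood $U$ of $x$ (in $[0,1]$) there exist $y,z\in U$ such that $f(y)<0<f(z)$. The cutting set $E(f)$ is the set of all $x\in[0,1]$ at which $f$ cuts the real axis. $C[0,1]$ is the space of continuous real functions on $[0,1]$, $\operatorname{cl}$ denotes closure, and $\chi_A$ is the characteristic function of $A$. *)

(* Defs.v *)
From HB Require Import structures.
From mathcomp Require Import all_boot all_order all_algebra.
From mathcomp Require Import all_classical all_reals all_analysis.
Set Implicit Arguments.
Unset Strict Implicit.
Unset Printing Implicit Defensive.
Import Order.TTheory GRing.Theory Num.Theory.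
Import numFieldNormedType.Exports.
Local Open Scope classical_set_scope.
Local Open Scope ring_scope.

(* A function [0,1] -> R is represented by a total function on R; every notion
   below depends only on its values on [0,1]. *)

Definition nowhere_dense (T : topologicalType) (A : set T) : Prop :=
  interior (closure A) = set0.

Definition cantor_set (R : realType) (D : set R) : Prop :=
  [/\ D !=set0, perfect_set D, compact D & nowhere_dense D].

(* The neighbourhoods of x in [0,1] are the sets U `&` `[0, 1] with U a
   neighbourhood of x in R. *)
Definition cuts_at (R : realType) (f : R -> R) (x : R) : Prop :=
  f x = 0 /\
  forall U : set R, nbhs x U ->
    exists y z : R, [/\ (U `&` `[0, 1]) y, (U `&` `[0, 1]) z & f y < 0 < f z].

Definition cutting_set (R : realType) (f : R -> R) : set R :=
  [set x | x \in `[0, 1] /\ cuts_at f x].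

Definition components (T : topologicalType) (A : set T) : set (set T) :=
  [set C | exists2 x, A x & C = connected_component A x].

Definition uniformly_convergent_series (T : choiceType) (R : realType)
    (A : set T) (u : nat -> T -> R) : Prop :=
  exists g : T -> R,
    {uniform A, (fun N x => \sum_(0 <= n < N) u n x) @ \oo --> g}.

Definition Mneg (R : realType) (f : R -> R) (W : nat -> set R) : set nat :=
  [set n | W n `&` f @^-1` `]-oo, 0[ !=set0].

Definition Mpos (R : realType) (f : R -> R) (W : nat -> set R) : set nat :=
  [set n | W n `&` f @^-1` `]0, +oo[ !=set0].

(* Main.v *)
Require Import Defs.
From HB Require Import structures.
From mathcomp Require Import all_boot all_order all_algebra.
From mathcomp Require Import all_classical all_reals all_analysis.
Set Implicit Arguments.
Unset Strict Implicit.
Unset Printing Implicit Defensive.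
Import Order.TTheory GRing.Theory Num.Theory.
Import numFieldNormedType.Exports.
Local Open Scope classical_set_scope.
Local Open Scope ring_scope.

(* At each point at most one term of the series is nonzero, so uniform
   convergence means that for every e > 0 only finitely many [W n] meet
   {|f| >= e}.  If f is continuous and vanishes on D, then {|f| >= e} is compact
   and covered by the disjoint open sets [W n], whence the finiteness.
   Conversely, near a point of D the finitely many components on which |f| may
   reach e are controlled by the continuity of f on their closures. *)

(** * Continuity and uniform convergence in epsilon form *)

Lemma within_continuous_distP (R : realType) (A : set R) (f : R -> R) :
  {within A, continuous f} <->
  forall x, A x -> forall e : R, 0 < e ->
    \forall y \near x, A y -> `|f x - f y| < e.
Proof.
rewrite subspace_continuousP; split=> fA x Ax.
  by move=> e e0; move/cvgrPdist_lt : (fA x Ax) => /(_ e e0).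
by apply/cvgrPdist_lt => e e0; exact: fA.
Qed.

Lemma uniform_cvg_distP (T : choiceType) (R : realType) (A : set T)
    (u : nat -> T -> R) (g : T -> R) :
  {uniform A, u @ \oo --> g} <->
  forall e : R, 0 < e ->
    \forall N \near \oo, forall x, A x -> `|g x - u N x| < e.
Proof.
rewrite restricted_cvgE; split=> [ug e e0|ug P].
  apply: (ug [set h | forall x, A x -> `|g x - h x| < e]).
  apply/uniform_nbhs; exists [set xy | ball xy.1 e xy.2]; split => //.
  exact: entourage_ball (PosNum e0).
move=> /uniform_nbhs[E [+ EP]]; rewrite -entourage_ballE => -[e /= e0 eE].
apply: filterS (ug e e0) => N uN; apply: EP => x Ax.
by apply: eE; exact: uN.
Qed.

(** A ball around [y] contained in [A] is an interval, hence connected, hence contained in the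
    component of [y]. *)
Lemma open_connected_component (R : realType) (A : set R) (x : R) :
  open A -> open (connected_component A x).
Proof.
move=> oA; rewrite openE => y xAy.
have /oA /nbhs_ballP[e /= e0 eA] := connected_component_sub xAy.
rewrite (same_connected_component xAy).
apply/nbhs_ballP; exists e => //; apply: connected_component_max => //.
  exact: ballxx.
apply/connected_intervalP => a b; rewrite ball_itv /= !in_itv /=.
move=> /andP[ya _] /andP[_ by_] c /andP[ac cb].
by rewrite in_itv /= (lt_le_trans ya ac) (le_lt_trans cb by_).
Qed.

(** * Families enumerating connected components *)

Section component_family.
Context (T : topologicalType) (I : Type) (U : set T) (W : I -> set T).
Context (WU : range W = components U).

Lemma component_familyE i x : W i x -> W i = connected_component U x.
Proof.
have : range W (W i) by exists i.
by rewrite WU => -[y Uy ->] /same_connected_component.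
Qed.

Lemma component_family_nonempty i : W i !=set0.
Proof.
have : range W (W i) by exists i.
rewrite WU => -[y Uy ->]; exists y; exact: connected_component_refl.
Qed.

Lemma component_family_sub i : W i `<=` U.
Proof.
by move=> x /[dup] /component_familyE ->; exact: connected_component_sub.
Qed.

Lemma component_family_cover x : U x -> exists i, W i x.
Proof.
move=> Ux; have [i _ Wi] : range W (connected_component U x).
  by rewrite WU; exists x.
by exists i; rewrite Wi; exact: connected_component_refl.
Qed.

Lemma component_family_connected i : connected (W i).
Proof.
have [x /component_familyE ->] := component_family_nonempty i.
exact: component_connected.
Qed.

Context (W_inj : injective W).

Lemma component_family_inj i j x : W i x -> W j x -> i = j.
Proof.
by move=> /component_familyE Wi /component_familyE Wj; apply: W_inj; rewrite Wi.
Qed.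

(** The member [W j] containing [x] is an open neighbourhood of [x], so it meets [W i], and then the
    two coincide. *)
Lemma component_family_closure i x :
  (forall j, open (W j)) -> closure (W i) x -> U x -> W i x.
Proof.
move=> oW Wix /component_family_cover[j Wjx].
have [y [Wiy Wjy]] := Wix _ (open_nbhs_nbhs (conj (oW j) Wjx)).
by rewrite (component_family_inj Wiy Wjy).
Qed.

End component_family.

(** Since 0 and 1 lie in [D], the closed interval may be replaced by the open one. *)
Lemma gap_set_open (R : realType) (D : set R) :
  closed D -> [set 0; 1] `<=` D -> open (`[0, 1] `\` D).
Proof.
move=> cD D01; rewrite (_ : _ `\` D = `]0, 1[ `\` D).
  by apply: openI; [exact: interval_open | exact: closed_openC].
apply/seteqP; split=> x [] /=; rewrite in_itv /= => /andP[x0 x1] Dx; last first.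
  by split=> //=; rewrite in_itv /= !ltW.
split=> //=; rewrite in_itv /= !lt_neqAle x0 x1 !andbT.
by apply/andP; split; apply/eqP => xE; apply: Dx; apply: D01;
  [left | right].
Qed.

Lemma compact_preimage (T S : topologicalType) (A : set T) (B : set S)
    (f : T -> S) :
  compact A -> {within A, continuous f} -> closed B ->
  compact (A `&` f @^-1` B).
Proof.
move=> cA /continuous_closedP fA /fA/closed_subspaceP[V cV VA].
by rewrite setIC -VA setIC; exact: compact_closedI.
Qed.

Lemma closed_norm_ge (R : realType) (e : R) : closed [set x : R | e <= `|x|].
Proof.
apply: (@preimage_closed _ _ _ [set y : R | e <= y]); last exact: closed_ge.
by move=> x _; exact: norm_continuous.
Qed.

Lemma perfect_three_points (R : realType) (D : set R) (x e : R) :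
  perfect_set D -> D x -> 0 < e ->
  exists a b c, [/\ [/\ D a, D b & D c], a < b < c, x - e < a & c < x + e].
Proof.
move=> [_ DD] + e0; rewrite -{1}DD => Dx.
have near_pt r : 0 < r -> exists y, [/\ y != x, D y & `|x - y| < r].
  by move=> r0; apply: Dx; apply/nbhs_ballP; exists r.
have [y [yx Dy xy]] := near_pt _ e0.
(* Choosing [z] strictly closer to [x] than [y] makes [x], [y], [z] pairwise distinct. *)
have [z [zx Dz xz]] : exists z, [/\ z != x, D z & `|x - z| < `|x - y|].
  by apply: near_pt; rewrite normr_gt0 subr_eq0 eq_sym.
have {}Dx : D x by rewrite -DD.
have zy : z != y by apply: contraTneq xz => ->; rewrite ltxx.
have : `|x - z| < e by exact: lt_trans xy.
move: xy; rewrite !ltr_distlC => /andP[xy1 xy2] /andP[xz1 xz2].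
have xx1 : x - e < x by rewrite ltrBlDr ltrDl.
have xx2 : x < x + e by rewrite ltrDl.
(* Of the eight sign patterns, six sort the three points and two are cyclic, hence absurd. *)
move: yx zx zy => /lt_total/orP[yx|yx] /lt_total/orP[zx|zx] /lt_total/orP[zy|zy].
- by exists z, y, x; rewrite zy yx.
- by exists y, z, x; rewrite zy zx.
- by have := lt_trans zx (lt_trans zy yx); rewrite ltxx.
- by exists y, x, z; rewrite yx zx.
- by exists z, x, y; rewrite yx zx.
- by have := lt_trans zx (lt_trans yx zy); rewrite ltxx.
- by exists x, z, y; rewrite zx zy.
- by exists x, y, z; rewrite yx zy.
Qed.

(** * Series with at most one nonzero term at each point *)

Lemma series_indic_eq (T : Type) (R : realType) (F : nat -> set T)
    (f : T -> R) (x : T) (n N : nat) :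
  F n x -> (forall m, F m x -> m = n) ->
  \sum_(0 <= k < N) \1_(F k) x * f x = if (n < N)%N then f x else 0.
Proof.
move=> Fnx Fx.
rewrite -(big_nat1_eq +%R (fun=> f x) n 0 N) [RHS]big_mkcond.
apply: eq_bigr => k _; rewrite indicE; case: eqP => [->|kn].
  by rewrite mem_set// mul1r.
by rewrite memNset ?mul0r// => /Fx.
Qed.

Lemma uniformly_convergent_series_indicP (T : choiceType) (R : realType)
    (A : set T) (F : nat -> set T) (f : T -> R) :
  (forall x, A x -> f x != 0 ->
    exists2 n, F n x & forall m, F m x -> m = n) ->
  uniformly_convergent_series A (fun n x => \1_(F n) x * f x) <->
  forall e : R, 0 < e ->
    \forall n \near \oo, forall x, A x -> F n x -> `|f x| < e.
Proof.
move=> F1; split=> [[g /uniform_cvg_distP Sg] e e0|small].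
  have [N _ SN] := Sg (e / 2) (divr_gt0 e0 (ltr0Sn _ 1)).
  exists N => // n /= Nn x Ax Fnx.
  have [->|fx0] := eqVneq (f x) 0; first by rewrite normr0.
  have [k Fkx kuniq] := F1 x Ax fx0; have nk := kuniq _ Fnx; subst k.
  (* At [x] the partial sums of lengths [N] and [n.+1] are 0 and [f x]; both are within [e / 2] of
     [g x]. *)
  have := SN N (leqnn N) x Ax; have := SN n.+1 (leqW Nn) x Ax.
  rewrite !(series_indic_eq _ _ Fnx kuniq) ltnSn ltnNge Nn /= subr0 distrC.
  move=> fg g0; rewrite -(subrK (g x) (f x)) [ltRHS]splitr.
  exact: le_lt_trans (ler_normD _ _) (ltrD fg g0).
(* The limit is [f] itself: the error at [x] is 0 once the single relevant index is below [N], and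
   [f x] before that. *)
exists f; apply/uniform_cvg_distP => e e0; have [N0 _ N0small] := small e e0.
exists N0 => // N /= N0N x Ax.
have [fx0|fx0] := eqVneq (f x) 0.
  by rewrite big1 ?fx0 ?subr0 ?normr0 // => k _; rewrite mulr0.
have [n Fnx nuniq] := F1 x Ax fx0; rewrite (series_indic_eq _ _ Fnx nuniq).
case: ltnP => Nn; first by rewrite subrr normr0.
by rewrite subr0; apply: (N0small n) => //=; exact: leq_trans Nn.
Qed.

(** An interval through [w] that leaves []a, b[] contains [a] or [b], both points of [D]. *)
Lemma connected_between_gap (R : realType) (D C : set R) (a b w : R) :
  D a -> D b -> connected C -> C `&` D = set0 -> C w -> a < w < b ->
  C `<=` `]a, b[.
Proof.
move=> Da Db /connected_intervalP iC CD Cw /andP[aw wb] v Cv.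
rewrite /= in_itv /= !ltNge; apply/andP; split; apply/negP => vab.
  have : (C `&` D) a.
    by split=> //; apply: (iC v w) => //; rewrite vab ltW.
  by rewrite CD.
have : (C `&` D) b.
  by split=> //; apply: (iC w v) => //; rewrite vab ltW.
by rewrite CD.
Qed.

(* Condition (ii) at [x] itself may be witnessed only by the component having
   [x] as an endpoint, with [P] far from [x]; at the middle one of three points
   of [D] it yields a component trapped between the outer two. *)
Lemma near_gap_meets (R : realType) (I : Type) (D P V : set R)
    (W : I -> set R) (x : R) :
  perfect_set D -> (forall n, connected (W n)) ->
  (forall n, W n `&` D = set0) ->
  D `<=` closure (\bigcup_(n in [set n | W n `&` P !=set0]) W n) ->
  D x -> nbhs x V -> exists n y, [/\ W n y, P y & V y].
Proof.
move=> pD cW WD DW Dx /nbhs_ballP[e /= e0 eV].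
have [a [b [c [[Da Db Dc] /andP[ab bc] xa cx]]]] :=
  perfect_three_points pD Dx e0.
have bac : nbhs b `]a, c[%classic.
  by apply: near_in_itvoo; rewrite in_itv /= ab bc.
have [w [[n [v [Wnv Pv]] Wnw]]] := DW b Db _ bac.
rewrite /= in_itv /= => awc; exists n, v; split=> //; apply: eV.
have := connected_between_gap Da Dc (cW n) (WD n) Wnw awc Wnv.
rewrite ball_itv /= !in_itv /= => /andP[av vc].
by rewrite (lt_trans xa av) (lt_trans vc cx).
Qed.

(** * The components of the complement of the Cantor set *)

Section gaps.
Context (R : realType) (f : R -> R) (D : set R) (W : nat -> set R).
Context (Dperfect : perfect_set D) (D_ends : [set 0; 1] `<=` D).
Context (W_inj : injective W) (W_comp : range W = components (`[0, 1] `\` D)).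

Lemma gap_open n : open (W n).
Proof.
have [x /(component_familyE W_comp) ->] := component_family_nonempty W_comp n.
by apply/open_connected_component/gap_set_open => //; case: Dperfect.
Qed.

Lemma gap_disjoint n : W n `&` D = set0.
Proof.
by apply/seteqP; split=> // x [/(component_family_sub W_comp)[]].
Qed.

Lemma gap_closure_sub n : closure (W n) `<=` `[0, 1].
Proof.
rewrite [X in _ `<=` X](closure_id _).1; last exact: interval_closed.
by apply: closureS => x /(component_family_sub W_comp)[].
Qed.

Lemma gap_closure_unique n x : x \in `[0, 1] -> ~ D x -> W n x ->
  forall m, closure (W m) x -> m = n.
Proof.
move=> x01 Dx Wnx m /(component_family_closure W_comp W_inj gap_open) Wmx.
exact: (component_family_inj W_comp W_inj (Wmx (conj x01 Dx))).
Qed.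

(** Endpoints of the components lie in [D], where [f] vanishes, so only interior points of a single
    component matter. *)
Lemma gap_closure_cover x : (forall y, D y -> f y = 0) ->
  x \in `[0, 1] -> f x != 0 ->
  exists2 n, closure (W n) x & forall m, closure (W m) x -> m = n.
Proof.
move=> f0 x01 fx; have nDx : ~ D x by move=> /f0; exact/eqP.
have [n Wnx] := component_family_cover W_comp (conj x01 nDx).
by exists n; [exact: subset_closure | exact: gap_closure_unique].
Qed.

Lemma gap_uniform : (forall x, D x -> f x = 0) ->
  {within `[0, 1], continuous f} ->
  uniformly_convergent_series `[0, 1]
    (fun n x => \1_(closure (W n)) x * f x).
Proof.
move=> f0 cf; apply/uniformly_convergent_series_indicP => [x|e e0].
  exact: gap_closure_cover.
have := compact_preimage (@segment_compact R 0 1) cf (@closed_norm_ge R e).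
rewrite compact_cover => /(_ nat setT W (fun n _ => @gap_open n)).
have nD x : e <= `|f x| -> ~ D x.
  by move=> + /f0 fx; rewrite fx normr0 leNgt e0.
case=> [x [/= x01 /nD Dx]|s _ sK].
  have [n Wnx] := component_family_cover W_comp (conj x01 Dx).
  by exists n.
(* This bound exceeds every index of the finite subcover [s], whereas a point of [closure (W n)]
   with [e <= |f x|] would force [n] into [s]. *)
exists (\max_(i <- finmap.enum_fset s) i.+1)%N => //= n sn x x01 Wnx.
rewrite ltNge; apply/negP => fx; have [i /= si Wix] := sK x (conj x01 fx).
move: sn; rewrite (gap_closure_unique x01 (nD _ fx) Wix Wnx).
by apply/negP; rewrite -ltnNge; exact: leq_bigmax_seq.
Qed.

Lemma gap_continuous : (forall x, D x -> f x = 0) ->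
  (forall n, {within closure (W n), continuous f}) ->
  uniformly_convergent_series `[0, 1]
    (fun n x => \1_(closure (W n)) x * f x) ->
  {within `[0, 1], continuous f}.
Proof.
move=> f0 cf /uniformly_convergent_series_indicP small.
apply/within_continuous_distP => x x01 e e0.
have cfe n : closure (W n) x ->
    \forall y \near x, closure (W n) y -> `|f x - f y| < e.
  by move=> Wnx; move/within_continuous_distP : (cf n); exact.
(* Off [D], the point [x] has an open component as a neighbourhood, so continuity on its closure
   suffices. *)
have [Dx|Dx] := pselect (D x); last first.
  have [n Wnx] := component_family_cover W_comp (conj x01 Dx).
  have Wn := open_nbhs_nbhs (conj (@gap_open n) Wnx).
  have Wnx' : closure (W n) x by exact: subset_closure.
  apply: filterS2 Wn (cfe n Wnx') => y Wny fxy _; apply: fxy.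
  exact: subset_closure.
have [N _ Nsmall] := small (fun y => gap_closure_cover f0) e e0.
(* If [x] is not in [closure (W n)], the estimate is vacuous on the open complement. *)
have near_gap n : \forall y \near x, closure (W n) y -> `|f x - f y| < e.
  have [/cfe //|Wnx] := pselect (closure (W n) x).
  have : nbhs x (~` closure (W n)).
    by apply: open_nbhs_nbhs; split=> //; exact/closed_openC/closed_closure.
  by apply: filterS => y.
(* Only the indices below [N] need a neighbourhood of their own; from [N] on, [|f| < e] holds on the
   whole closure. *)
have := filter_forall (nbhs_filter x) (fun n : 'I_N => near_gap n).
apply: filterS => y yN y01; rewrite (f0 x Dx) sub0r normrN.
have [/f0 ->|Dy] := pselect (D y); first by rewrite normr0.
have [n /subset_closure Wny] := component_family_cover W_comp (conj y01 Dy).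
have [nN|Nn] := ltnP n N; last exact: (Nsmall n).
by have := yN (Ordinal nN) Wny; rewrite (f0 x Dx) sub0r normrN.
Qed.

(** A point of [P] in [[0, 1]] avoids [D], so it lies in a component, which then meets [P]. The sets
    where [f] is negative and where it is positive both serve as [P]. *)
Lemma closure_gaps_of_near (P : set R) x :
  (forall y, P y -> ~ D y) ->
  (forall U, nbhs x U -> (U `&` `[0, 1] `&` P) !=set0) ->
  closure (\bigcup_(n in [set n | W n `&` P !=set0]) W n) x.
Proof.
move=> PD xP U /xP[y [[Uy y01] Py]].
have [n Wny] := component_family_cover W_comp (conj y01 (PD y Py)).
by exists y; split=> //; exists n => //; exists y.
Qed.

End gaps.

Theorem theorem2p2 (R : realType) (f : R -> R) (D : set R) (W : nat -> set R)
    (D01 : D `<=` `[0, 1]) (Dcantor : cantor_set D) (D_ends : [set 0; 1] `<=` D)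
    (W_inj : injective W) (W_comp : range W = components (`[0, 1] `\` D)) :
  ({within `[0, 1], continuous f} /\ D `<=` cutting_set f) <->
  ([/\ forall x, D x -> f x = 0,
       forall n, {within closure (W n), continuous f} &
       uniformly_convergent_series `[0, 1]
         (fun n x => \1_(closure (W n)) x * f x)] /\
   D `<=` closure (\bigcup_(n in Mneg f W) W n) `&`
          closure (\bigcup_(n in Mpos f W) W n)).
Proof.
have [_ Dperf _ _] := Dcantor; split=> [[cf Dcut]|[[f0 cfW fU] DW]].
  have f0 x : D x -> f x = 0 by move=> /Dcut[_ []].
  split; first split=> //.
  - move=> n; apply: continuous_subspaceW cf; exact: gap_closure_sub W_comp n.
  - exact: (gap_uniform Dperf D_ends W_inj W_comp).
  move=> x /Dcut[_ [_ xcut]]; split; apply: (closure_gaps_of_near W_comp).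
  - by move=> y /=; rewrite in_itv /= => fy /f0 fy0; rewrite fy0 ltxx in fy.
  - move=> U /xcut[y [z [Uy Uz /andP[fy fz]]]].
    by exists y; split=> //=; rewrite in_itv.
  - move=> y /=; rewrite in_itv /= andbT => fy /f0 fy0.
    by rewrite fy0 ltxx in fy.
  - move=> U /xcut[y [z [Uy Uz /andP[fy fz]]]].
    by exists z; split=> //=; rewrite in_itv /= andbT.
split; first exact: (gap_continuous Dperf D_ends W_inj W_comp).
move=> x Dx; split; first exact: D01.
split=> [|U xU]; first exact: f0.
have cW n : connected (W n) by exact: component_family_connected W_comp n.
have WD n := gap_disjoint W_comp n.
have W01 n y : W n y -> y \in `[0, 1] by move=> /(component_family_sub W_comp)[].
(* Condition (ii) is used at all points of [D], not only at [x], to find values of each sign inside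
   [U]. *)
have [n [y [Wny fy Uy]]] :=
  near_gap_meets Dperf cW WD (fun t Dt => (DW t Dt).1) Dx xU.
have [m [z [Wmz fz Uz]]] :=
  near_gap_meets Dperf cW WD (fun t Dt => (DW t Dt).2) Dx xU.
exists y, z; split; [by split=> //; exact: W01 Wny|by split=> //; exact: W01 Wmz|].
by move: fy fz; rewrite /= !in_itv /= andbT => -> ->.
Qed.
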